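(* Let $X$ have finite support, let $x=(x_1,\dots,x_T)$ be a regressor path with $P^{\mathrm{obs}}(X=x)>0$, and suppose the conditional law of $Y$ given $X=x$ has finite support: $P^{\mathrm{obs}}(Y=y^j\mid X=x)=p_j>0$ for distinct $y^1,\dots,y^J\in\mathbb R^T$, $\sum_{j=1}^Jp_j=1$. Fix $b\in\mathcal B$, put $z_{jt}(b)=y_t^j-x_t'b$, and let $v_1<\dots<v_P$ be the distinct values among $\{z_{jt}(b):1\le j\le J,1\le t\le T\}$. Let $\mathrm{LS}(x,b)$ denote the following linear system in unknowns $(q_{jp})_{j\le J,p\le P}$ (where $J$, $y^j$, $p_j$, $z_{jt}(b)$, $P$, $v_p$ are those just defined for the path $x$ and candidate $b$): $$q_{jp}\ge0\ \ (j\le J,\ p\le P),\qquad \sum_{p=1}^Pq_{jp}=p_j\ \ (j\le J),$$ $$\sum_{j:\,z_{jt}(b)\le v_p}q_{jp}\ \ge\ \tau\sum_{j=1}^Jq_{jp},\qquad \sum_{j:\,z_{jt}(b)<v_p}q_{jp}\ \le\ \tau\sum_{j=1}^Jq_{jp}\qquad(p\le P,\ t\le T).$$ Then a feasible conditional latent coupling exists for the path $x$ and candidate $b$ if and only if $\mathrm{LS}(x,b)$ is feasible. Consequently, if $X$ and every conditional outcome distribution of $Y$ given a positive-probability path of $X$ have finite support, then $$\Theta_I=\{b\in\mathcal B:\ \mathrm{LS}(x,b)\text{ is feasible for every path } x \text{ with } P^{\mathrm{obs}}(X=x)>0\}.$$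
   Context: $T,k\ge1$ are fixed integers, $\tau\in(0,1)$, $\mathcal B\subseteq\mathbb R^k$. $Y=(Y_1,\dots,Y_T)'\in\mathbb R^T$, $X=(X_1,\dots,X_T)$ with $X_t\in\mathbb R^k$, and $P^{\mathrm{obs}}$ is the law of $(Y,X)$. $R_t(b)=Y_t-X_t'b$. Identified set: $\Theta_I$ is the set of $b\in\mathcal B$ for which there exists a Borel probability law $P^{\mathrm s}$ of $(Y,X,A,U)$, $A\in\mathbb R$, $U\in\mathbb R^T$, with $(Y,X)$-marginal $P^{\mathrm{obs}}$, with $Y_t=X_t'b+A+U_t$ a.s. for all $t$, and with $P^{\mathrm s}(U_t\le0\mid X,A)\ge\tau$, $P^{\mathrm s}(U_t<0\mid X,A)\le\tau$ a.s. for all $t$. Equivalently, there is a Borel law $\pi$ of $(Y,X,A)$ with $(Y,X)$-marginal $P^{\mathrm{obs}}$ such that $\pi\{R_t(b)\le A\mid X,A\}\ge\tau$ and $\pi\{R_t(b)<A\mid X,A\}\le\tau$ a.s. for all $t$. Feasible conditional latent coupling for path $x$ and candidate $b$: a Borel probability law $\pi_x$ of $(Y,A)\in\mathbb R^T\times\mathbb R$ whose $Y$-marginal is the conditional law of $Y$ given $X=x$ under $P^{\mathrm{obs}}$ and such that, for all $t\le T$, $\pi_x\{Y_t-x_t'b\le A\mid A\}\ge\tau$ and $\pi_x\{Y_t-x_t'b<A\mid A\}\le\tau$ $\pi_x$-a.s. *)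

(* Defs.v *)
From HB Require Import structures.
From mathcomp Require Import all_boot all_order all_algebra.
From mathcomp Require Import all_classical all_reals all_analysis.

Set Implicit Arguments.
Unset Strict Implicit.
Unset Printing Implicit Defensive.

Import Order.TTheory GRing.Theory Num.Theory.
Import numFieldNormedType.Exports.

Local Open Scope classical_set_scope.
Local Open Scope ring_scope.

(* R^n with the product of the Borel sigma-algebras of R, which is the Borel
   sigma-algebra of R^n. *)
Notation vec R n := (n.-tuple (measurableTypeR R)).

Notation xpath R T k := (T.-tuple (vec R k)).

Definition dotv (R : realType) (k : nat) (u w : vec R k) : R :=
  \sum_(i < k) (tnth u i : R) * tnth w i.

Definition resid (R : realType) (T k : nat) (y : vec R T) (x : xpath R T k)
    (b : vec R k) (t : 'I_T) : R :=
  (tnth y t : R) - dotv (tnth x t) b.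

(* [g \o f] is a version of the conditional probability P(E | f) of the event E
   given the sigma-algebra generated by the random element f. *)
Definition is_cond_prob (R : realType) (d d' : measure_display)
    (W : measurableType d) (V : measurableType d') (P : probability W R)
    (f : W -> V) (E : set W) (g : V -> R) : Prop :=
  measurable_fun [set: V] g /\
  forall C : set V, measurable C ->
    (\int[P]_(w in f @^-1` C) (g (f w))%:E = P (E `&` f @^-1` C))%E.

(* Versions of P(E | f) exist and agree P-almost surely, so an almost sure bound
   on P(E | f) may be read on any one of them. *)
Definition cond_prob_ge (R : realType) (d d' : measure_display)
    (W : measurableType d) (V : measurableType d') (P : probability W R)
    (f : W -> V) (E : set W) (c : R) : Prop :=
  exists g : V -> R,
    is_cond_prob P f E g /\ {ae P, forall w, c <= g (f w)}.

Definition cond_prob_le (R : realType) (d d' : measure_display)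
    (W : measurableType d) (V : measurableType d') (P : probability W R)
    (f : W -> V) (E : set W) (c : R) : Prop :=
  exists g : V -> R,
    is_cond_prob P f E g /\ {ae P, forall w, g (f w) <= c}.

(* In the structural law a point is w = (Y, X, A, U), nested to the left:
   Y = w.1.1.1, X = w.1.1.2, A = w.1.2, U = w.2. *)
Definition structural_law (R : realType) (T k : nat) (tau : R)
    (Pobs : probability (vec R T * xpath R T k)%type R) (b : vec R k)
    (Ps : probability
      (vec R T * xpath R T k * measurableTypeR R * vec R T)%type R) : Prop :=
  [/\ forall D : set (vec R T * xpath R T k), measurable D ->
        Ps [set w | D w.1.1] = Pobs D,
      forall t : 'I_T, {ae Ps, forall w,
        (tnth w.1.1.1 t : R) =
        dotv (tnth w.1.1.2 t) b + w.1.2 + tnth w.2 t},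
      forall t : 'I_T,
        cond_prob_ge Ps (fun w => (w.1.1.2, w.1.2))
          [set w | (tnth w.2 t : R) <= 0] tau &
      forall t : 'I_T,
        cond_prob_le Ps (fun w => (w.1.1.2, w.1.2))
          [set w | (tnth w.2 t : R) < 0] tau].

Definition identified_set (R : realType) (T k : nat) (tau : R)
    (B : set (vec R k)) (Pobs : probability (vec R T * xpath R T k)%type R) :
    set (vec R k) :=
  [set b | B b /\ exists Ps, structural_law tau Pobs b Ps].

Definition probX (R : realType) (T k : nat)
    (Pobs : probability (vec R T * xpath R T k)%type R) (x : xpath R T k) : R :=
  fine (Pobs ([set: vec R T] `*` [set x])).

Definition X_finite_support (R : realType) (T k : nat)
    (Pobs : probability (vec R T * xpath R T k)%type R) : Prop :=
  exists F : set (xpath R T k),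
    finite_set F /\ Pobs ([set: vec R T] `*` F) = 1%E.

(* P(Y \in C | X = x); only meaningful when P(X = x) > 0. *)
Definition cond_law (R : realType) (T k : nat)
    (Pobs : probability (vec R T * xpath R T k)%type R) (x : xpath R T k)
    (C : set (vec R T)) : R :=
  fine (Pobs (C `*` [set x])) / probX Pobs x.

Definition cond_atoms (R : realType) (T k : nat)
    (Pobs : probability (vec R T * xpath R T k)%type R) (x : xpath R T k)
    (J : nat) (y : 'I_J -> vec R T) (p : 'I_J -> R) : Prop :=
  [/\ injective y,
      forall j, 0 < p j,
      forall j, cond_law Pobs x [set y j] = p j &
      \sum_(j < J) p j = 1].

Definition feasible_coupling (R : realType) (T k : nat) (tau : R)
    (Pobs : probability (vec R T * xpath R T k)%type R) (x : xpath R T k)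
    (b : vec R k)
    (pi : probability (vec R T * measurableTypeR R)%type R) : Prop :=
  [/\ forall C : set (vec R T), measurable C ->
        pi [set w | C w.1] = (cond_law Pobs x C)%:E,
      forall t : 'I_T,
        cond_prob_ge pi snd [set w | resid w.1 x b t <= w.2] tau &
      forall t : 'I_T,
        cond_prob_le pi snd [set w | resid w.1 x b t < w.2] tau].

(* The list v_1 < ... < v_P of the distinct values of z; P is its size and v_p is
   read with 0-based indices. *)
Definition distinct_values (R : realType) (T J : nat)
    (z : 'I_J -> 'I_T -> R) : seq R :=
  sort <=%R (undup [seq z j t | j <- enum 'I_J, t <- enum 'I_T]).

Definition LS_feasible (R : realType) (T k : nat) (tau : R) (x : xpath R T k)
    (b : vec R k) (J : nat) (y : 'I_J -> vec R T) (p : 'I_J -> R) : Prop :=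
  let z := fun (j : 'I_J) (t : 'I_T) => resid (y j) x b t in
  let v := distinct_values z in
  exists q : 'I_J -> 'I_(size v) -> R,
    [/\ forall j i, 0 <= q j i,
        forall j, \sum_i q j i = p j,
        forall (i : 'I_(size v)) t,
          tau * \sum_j q j i <= \sum_(j | z j t <= v`_i) q j i &
        forall (i : 'I_(size v)) t,
          \sum_(j | z j t < v`_i) q j i <= tau * \sum_j q j i].

(* Main.v *)
Require Import Defs.
From HB Require Import structures.
From mathcomp Require Import all_boot all_order all_algebra.
From mathcomp Require Import all_classical all_reals all_analysis.
From mathcomp Require Import measurable_realfun ring.

Set Implicit Arguments.
Unset Strict Implicit.
Unset Printing Implicit Defensive.

Import Order.TTheory GRing.Theory Num.Theory.
Import numFieldNormedType.Exports.

Local Open Scope classical_set_scope.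
Local Open Scope ring_scope.

(* A bound tau <= P(E | f) or P(E | f) <= tau holds almost surely if and only if
   the corresponding inequality between tau P(f^-1 C) and P(E `&` f^-1 C) holds
   for every measurable C. In this form both bounds are linear in the law, so
   couplings can be conditioned on X = x and mixed over the finitely many paths
   x, which reduces membership in the identified set to the existence of a
   feasible coupling for each path.

   For one path with finitely many outcomes, a solution q of the linear system is
   the coupling with mass q_jp at (y^j, v_p). Conversely, given a coupling, let
   q_jp be the mass of Y = y^j with A in the bin [v_p, v_(p+1)), the last bin being
   [v_P, +oo). Within a bin {z <= A} is {z <= v_p} and {z < v_p} is contained in
   {z < A}, so both inequalities pass to v_p; no residual lies at or below an A
   smaller than v_1, so the lower bound makes that region null. *)

(** * Probability laws from measures of mass one, pushforwards and finite mixtures *)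

Section finite_mixtures.
Local Open Scope ereal_scope.
Context d (T : measurableType d) (R : realType).

Lemma probability_exists (mu : {measure set T -> \bar R}) : mu setT = 1 ->
  exists P : probability T R, forall D, P D = mu D.
Proof.
(* [point] is only the fallback for a mass that cannot be normalized; with mass 1 the normalization
   changes nothing. *)
move=> mu1; exists (mnormalize mu point) => D /=.
rewrite /mnormalize; set e := mu [set: _]; have -> : e = 1 by exact: mu1.
by rewrite onee_eq0/= invr1 mule1.
Qed.

Lemma pushforward_exists d' (S : measurableType d')
    (mu : {measure set S -> \bar R}) (f : S -> T) : measurable_fun setT f ->
  exists nu : {measure set T -> \bar R}, forall D, nu D = mu (f @^-1` D).
Proof.
(* The canonical measure on a pushforward is indexed by the measurability proof,
   which unification leaves open: nu' is a function of it. *)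
move=> mf; pose nu' : {measure set T -> \bar R} := pushforward mu f.
by exists (nu' mf).
Qed.

Lemma mixture_exists (I : Type) (s : seq I) (w : I -> R)
    (P : I -> probability T R) :
  (forall i, (0 <= w i)%R) -> (\sum_(i <- s) w i = 1)%R ->
  exists Q : probability T R, forall D, Q D = \sum_(i <- s) (w i)%:E * P i D.
Proof.
move=> w0 w1.
have [mu muE] : exists mu : {measure set T -> \bar R},
    forall D, mu D = \sum_(i <- s) (w i)%:E * P i D.
  elim: s {w1} => [|i s [mu IH]].
    by exists mzero => D; rewrite big_nil.
  (* Only [m 0] and [m 1] enter [msum m 2]; the value at larger indices is arbitrary. *)
  pose m n : {measure set T -> \bar R} :=
    if n is 0%N then mscale (NngNum (w0 i)) (P i) else mu.
  by exists (msum m 2) => D; rewrite big_cons -IH /= /msum !big_ord_recl big_ord0 adde0.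
have [|Q QE] := @probability_exists mu.
  rewrite muE; transitivity (\sum_(i <- s) w i)%:E; last by rewrite w1.
  by rewrite -sumEFin; apply: eq_bigr => i _; rewrite probability_setT mule1.
by exists Q => D; rewrite QE muE.
Qed.

End finite_mixtures.

(** * Splitting a measure along finitely many fibers *)

Section fibers.
Local Open Scope ereal_scope.
Context d (T : measurableType d) (R : realType) (V : choiceType).
Variables (f : T -> V) (s : seq V).
Hypotheses (us : uniq s) (mfib : forall v, v \in s -> measurable (f @^-1` [set v])).

Let mfibs : measurable [set w | f w \in s].
Proof.
rewrite (_ : mkset _ = \big[setU/set0]_(v <- s) (f @^-1` [set v])).
  by rewrite big_seq_cond; apply: bigsetU_measurable => v /andP[vs _]; exact: mfib.
rewrite -bigcup_seq; apply/seteqP; split=> w /=.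
  by move=> fs; exists (f w).
by move=> [v vs /= ->].
Qed.

Lemma measure_fibers (mu : {measure set T -> \bar R}) (D : set T) :
  measurable D ->
  mu (D `&` [set w | f w \in s]) = \sum_(v <- s) mu (D `&` f @^-1` [set v]).
Proof.
move=> mD; rewrite fsbig_seq// -measure_fin_bigcup//.
- congr (mu _); apply/seteqP; split=> w /=.
    by move=> [Dw fs]; exists (f w).
  by move=> [v vs [Dw /= ->]].
- by apply/trivIsetP => u v _ _ uv; apply/seteqP; split=> w //= [[_ wu] [_ wv]];
    rewrite -wu -wv eqxx in uv.
- by move=> v vs; apply: measurableI => //; exact: mfib.
Qed.

(** Fibers of total mass 1 leave a null complement, so [D] loses nothing outside them, and [f] takes
    values in [s] almost surely. *)
Lemma probability_fibers (P : probability T R) (D : set T) : measurable D ->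
  \sum_(v <- s) P (f @^-1` [set v]) = 1 ->
  P D = \sum_(v <- s) P (D `&` f @^-1` [set v]).
Proof.
move=> mD sP1; rewrite -measure_fibers//.
have P1 : P [set w | f w \in s] = 1.
  rewrite -[X in P X]setTI measure_fibers// -sP1.
  by apply: eq_bigr => v _; rewrite setTI.
rewrite [LHS](measureDI _ mD mfibs) [X in X + _ = _](_ : _ = 0) ?add0e//.
apply/eqP; rewrite eq_le measure_ge0 andbT.
rewrite -[leRHS](subee (x := P [set w | f w \in s])) ?fin_num_measure//.
rewrite {1}P1 -probability_setC//.
by apply: le_measure; rewrite ?inE; [exact: measurableD|exact: measurableC|move=> w []].
Qed.

End fibers.

(** * Almost sure comparison of events, and measurability of singletons *)

Lemma ae_mono d (T : measurableType d) (R : realType)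
    (mu : {measure set T -> \bar R}) (P Q : T -> Prop) :
  (forall w, P w -> Q w) ->
  {ae mu, forall w, P w} -> {ae mu, forall w, Q w}.
Proof. by move=> PQ; apply: filterS. Qed.

(** Enlarging [B] by the exceptional null set costs no mass and makes the inclusion hold
    everywhere. *)
Lemma le_measure_ae d (T : measurableType d) (R : realType)
    (mu : {measure set T -> \bar R}) (A B : set T) :
  measurable A -> measurable B -> {ae mu, forall w, A w -> B w} ->
  (mu A <= mu B)%E.
Proof.
move=> mA mB [N [mN N0 AB]].
apply: (@le_trans _ _ (mu (B `|` N))); last first.
  by apply: le_trans (measureU2 _ mB mN) _; rewrite [X in (_ + X)%E](_ : _ = 0%E) ?adde0.
apply: le_measure; rewrite ?inE//; first exact: measurableU.
move=> w Aw; have [Bw|nBw] := pselect (B w); first by left.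
by right; apply: AB => /= /(_ Aw).
Qed.

Lemma measurable_preimage d d' (T : measurableType d) (U : measurableType d')
    (f : T -> U) (C : set U) :
  measurable_fun setT f -> measurable C -> measurable (f @^-1` C).
Proof. by move=> mf mC; rewrite -[X in measurable X]setTI; exact: mf. Qed.

(** A singleton is a finite intersection of coordinate conditions. Applied twice, this covers
    regressor paths, which are tuples of tuples. *)
Lemma measurable_tuple1 d (T : measurableType d) n :
  (forall a : T, measurable [set a]) ->
  forall x : n.-tuple T, measurable [set x].
Proof.
move=> m1 x.
rewrite (_ : [set x] =
    \big[setI/setT]_(i < n) ((@tnth n T)^~ i @^-1` [set tnth x i])).
  apply: bigsetI_measurable => i _.
  exact: measurable_preimage (measurable_tnth i) (m1 _).
apply/seteqP; split => y /=.
  by move=> ->; elim/big_ind : _ => //.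
move=> H; apply: eq_from_tnth => i.
by move: H; rewrite (bigD1 i)//= => -[].
Qed.

(** * Conditional probability bounds as inequalities between measures *)

Section conditional_probability_bounds.
Local Open Scope ereal_scope.

(** The integrands may change sign, so positive parts are compared directly and negative parts in
    the opposite order. *)
Lemma ae_le_integral d (T : measurableType d) (R : realType)
    (mu : {measure set T -> \bar R}) (D : set T) (f g : T -> \bar R) :
  measurable D -> measurable_fun D f -> measurable_fun D g ->
  {ae mu, forall x, D x -> f x <= g x} ->
  \int[mu]_(x in D) f x <= \int[mu]_(x in D) g x.
Proof.
move=> mD mf mg fg; rewrite integralE [leRHS]integralE; apply: leeB.
- apply: ae_ge0_le_integral => //; try exact: measurable_funepos.
  apply: filterS fg => x fgx Dx; rewrite !funeposE.
  by rewrite ge_max !le_max fgx//= lexx orbT.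
- apply: ae_ge0_le_integral => //; try exact: measurable_funeneg.
  apply: filterS fg => x fgx Dx; rewrite !funenegE.
  by rewrite ge_max !le_max leeN2 fgx//= lexx orbT.
Qed.

(** On measurable subsets of the set where [g < f], the integrals are ordered both ways, hence
    equal. So [f] and [g] agree almost everywhere on that set, which must therefore be null. *)
Lemma integral_le_ae_le d (T : measurableType d) (R : realType)
    (mu : {measure set T -> \bar R}) (f g : T -> \bar R) :
  mu.-integrable setT f -> mu.-integrable setT g ->
  (forall C, measurable C -> \int[mu]_(x in C) f x <= \int[mu]_(x in C) g x) ->
  {ae mu, forall x, f x <= g x}.
Proof.
move=> fi gi fg.
have mf := measurable_int _ fi; have mg := measurable_int _ gi.
pose N := [set x | g x < f x].
have mN : measurable N by rewrite -[N]setTI; exact: measurable_lte.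
have : ae_eq mu N f g.
  apply: integral_ae_eq => //.
  - exact: integrableS fi.
  - exact: measurable_funS mg.
  move=> E EN mE; apply/eqP; rewrite eq_le fg//=.
  by apply: le_integral => //; [exact: integrableS gi|exact: integrableS fi|
     move=> x /set_mem/EN/ltW].
apply: filterS => x; rewrite /N/= => fgx.
by rewrite leNgt; apply/negP => gf; move: (gf); rewrite fgx// ltxx.
Qed.

Context d d' (W : measurableType d) (V : measurableType d') (R : realType).
Variables (P : probability W R) (f : W -> V) (E : set W).
Hypotheses (mf : measurable_fun setT f) (mE : measurable E).

Let mpre C : measurable C -> measurable (f @^-1` C).
Proof. exact: measurable_preimage. Qed.

(** Take for [g] the Radon-Nikodym density, with respect to the law of [f], of the law of [f]
    restricted to the event [E]. The last two clauses stay on [V], where densities can be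
    compared. *)
Lemma is_cond_prob_exists : exists g : V -> R,
  [/\ is_cond_prob P f E g,
      (pushforward P f).-integrable setT (EFin \o g) &
      forall C, measurable C ->
        \int[pushforward P f]_(v in C) (g v)%:E = P (E `&` f @^-1` C)].
Proof.
pose X : {mfun W >-> V} := HB.pack f (isMeasurableFun.Build _ _ _ _ _ mf).
pose mu := distribution P X.
pose nu0' : {measure set V -> \bar R} := pushforward (mrestr P mE) X.
pose nu0 := nu0' mf.
have nu0fin : fin_num_fun nu0.
  move=> C mC; rewrite /nu0/= /pushforward/= /mrestr fin_num_measure//.
  by apply: measurableI => //; exact: mpre.
pose nu : {finite_measure set V -> \bar R} :=
  HB.pack (nu0 : set V -> \bar R) (Measure.class nu0) (Measure_isFinite.Build _ _ _ _ nu0fin).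
(* Restricting to [E] only lowers mass, so a set null for the law of [f] is null for [nu]. *)
have numu : nu `<< mu.
  apply/null_content_dominatesP => C mC muC.
  apply/eqP; rewrite eq_le measure_ge0 andbT -[leRHS]muC.
  by apply: le_measure; rewrite ?inE; [apply: measurableI => //|..|exact: subIsetl];
    exact: mpre.
have [h [h0 hfin hi hE]] := radon_nikodym_sigma_finite numu.
have gh : EFin \o (fine \o h) = h by apply/funext => v /=; rewrite fineK.
have mh : measurable_fun setT (fine \o h).
  exact: measurableT_comp _ (measurable_int _ hi).
have intE C : measurable C ->
    \int[pushforward P f]_(v in C) (fine (h v))%:E = P (E `&` f @^-1` C).
  move=> mC; under eq_integral do rewrite fineK//.
  by rewrite -[LHS]hE//= /nu0/= /pushforward/= /mrestr setIC.
exists (fine \o h); split => //; last by rewrite gh.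
split=> // C mC; rewrite -intE// ge0_integral_pushforward//.
- apply/measurable_EFinP; exact: measurable_funTS.
- by move=> v _; rewrite lee_fin fine_ge0.
Qed.

Lemma ae_pushforward (Q : V -> Prop) :
  {ae pushforward P f, forall v, Q v} -> {ae P, forall w, Q (f w)}.
Proof.
move=> [N [mN N0 QN]]; exists (f @^-1` N); split => //; first exact: mpre.
by move=> w /= nQ; exact: QN.
Qed.

(** Left to right integrates the bound over the preimage of [C]. Right to left compares the constant
    with the density under the law of [f], then pulls the exceptional set back along [f]. *)
Lemma cond_prob_geP (c : R) : cond_prob_ge P f E c <->
  forall C, measurable C -> c%:E * P (f @^-1` C) <= P (E `&` f @^-1` C).
Proof.
split=> [[g [[mg gE] cg]] C mC|H].
  rewrite -gE// -integral_cst; last exact: mpre.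
  apply: ae_le_integral => //; first exact: mpre.
  - apply/measurable_EFinP; apply: measurable_funTS.
    exact: measurableT_comp.
  - by apply: filterS cg => w cgw _; rewrite lee_fin.
have [g [gP gi gE]] := is_cond_prob_exists.
exists g; split => //; apply: (@ae_pushforward (fun v => (c <= g v)%R)).
pose X : {mfun W >-> V} := HB.pack f (isMeasurableFun.Build _ _ _ _ _ mf).
suff: {ae distribution P X, forall v, c%:E <= (g v)%:E}.
  by apply: filterS => v; rewrite lee_fin.
apply: integral_le_ae_le => //; first exact: finite_measure_integrable_cst.
by move=> C mC; rewrite integral_cst//= gE//; exact: H.
Qed.

Lemma cond_prob_leP (c : R) : cond_prob_le P f E c <->
  forall C, measurable C -> P (E `&` f @^-1` C) <= c%:E * P (f @^-1` C).
Proof.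
split=> [[g [[mg gE] gc]] C mC|H].
  rewrite -gE// -integral_cst; last exact: mpre.
  apply: ae_le_integral => //; first exact: mpre.
  - apply/measurable_EFinP; apply: measurable_funTS.
    exact: measurableT_comp.
  - by apply: filterS gc => w gcw _; rewrite lee_fin.
have [g [gP gi gE]] := is_cond_prob_exists.
exists g; split => //; apply: (@ae_pushforward (fun v => (g v <= c)%R)).
pose X : {mfun W >-> V} := HB.pack f (isMeasurableFun.Build _ _ _ _ _ mf).
suff: {ae distribution P X, forall v, (g v)%:E <= c%:E}.
  by apply: filterS => v; rewrite lee_fin.
apply: integral_le_ae_le => //; first exact: finite_measure_integrable_cst.
by move=> C mC; rewrite integral_cst//= gE//; exact: H.
Qed.

End conditional_probability_bounds.

(** * Path probabilities, conditional laws and measurability of residual events *)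

Section observed_law.
Context (R : realType) (T k : nat).
Variable Pobs : probability (vec R T * xpath R T k)%type R.
Implicit Types (x : xpath R T k) (b : vec R k) (y : vec R T).

Lemma measurable_vec1 n (y : vec R n) : measurable [set y].
Proof. by apply: measurable_tuple1 => a; exact: measurable_set1. Qed.

Lemma measurable_xpath1 x : measurable [set x].
Proof. by apply: measurable_tuple1 => a; exact: measurable_vec1. Qed.

Lemma probXE x : (probX Pobs x)%:E = Pobs ([set: vec R T] `*` [set x]).
Proof.
rewrite fineK// fin_num_measure//.
by apply: measurableX => //; exact: measurable_xpath1.
Qed.

Lemma probX_ge0 x : 0 <= probX Pobs x.
Proof. by rewrite -lee_fin probXE measure_ge0. Qed.

Lemma cond_lawE x (C : set (vec R T)) : measurable C ->
  (cond_law Pobs x C)%:E = ((probX Pobs x)^-1%:E * Pobs (C `*` [set x]))%E.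
Proof.
move=> mC; rewrite /cond_law EFinM muleC fineK// fin_num_measure//.
by apply: measurableX => //; exact: measurable_xpath1.
Qed.

Lemma measurable_resid x b t :
  measurable_fun setT (fun y : vec R T => resid y x b t).
Proof. by apply: measurable_funB => //; exact: measurable_tnth. Qed.

Lemma measurable_resid_le x b t :
  measurable [set w : vec R T * measurableTypeR R | resid w.1 x b t <= w.2].
Proof.
have mr := measurableT_comp (measurable_resid x b t)
  (@measurable_fst _ _ (vec R T) (measurableTypeR R)).
have := measurable_fun_ler mr (@measurable_snd _ _ (vec R T) (measurableTypeR R)).
by move=> /(_ measurableT [set true] Logic.I); rewrite setTI.
Qed.

Lemma measurable_resid_lt x b t :
  measurable [set w : vec R T * measurableTypeR R | resid w.1 x b t < w.2].
Proof.
have mr := measurableT_comp (measurable_resid x b t)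
  (@measurable_fst _ _ (vec R T) (measurableTypeR R)).
have := measurable_fun_ltr mr (@measurable_snd _ _ (vec R T) (measurableTypeR R)).
by move=> /(_ measurableT [set true] Logic.I); rewrite setTI.
Qed.

End observed_law.

(** * Passing between a structural law and one coupling per path *)

Section structural_laws_and_couplings.
Context (R : realType) (T k : nat) (tau : R).
Variable Pobs : probability (vec R T * xpath R T k)%type R.
Implicit Types (x : xpath R T k) (b : vec R k).

Local Notation world := (vec R T * xpath R T k * measurableTypeR R * vec R T)%type.

Let mX12 : measurable_fun setT (fun w : world => w.1.1.2).
Proof.
exact: measurableT_comp measurable_snd (measurableT_comp measurable_fst measurable_fst).
Qed.

Let mX111 : measurable_fun setT (fun w : world => w.1.1.1).
Proof.
exact: measurableT_comp measurable_fst (measurableT_comp measurable_fst measurable_fst).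
Qed.

Let mA : measurable_fun setT (fun w : world => w.1.2).
Proof. exact: measurableT_comp measurable_snd measurable_fst. Qed.

Let mXA : measurable_fun setT (fun w : world => (w.1.1.2, w.1.2)).
Proof. exact: measurable_fun_pair. Qed.

Let mU t : measurable_fun setT (fun w : world => (tnth w.2 t : R)).
Proof. exact: measurableT_comp (measurable_tnth t) measurable_snd. Qed.

Let mU_le0 t : measurable [set w : world | (tnth w.2 t : R) <= 0].
Proof.
have := measurable_fun_ler (mU t) (measurable_cst (0 : R)).
by move=> /(_ measurableT [set true] Logic.I); rewrite setTI.
Qed.

Let mU_lt0 t : measurable [set w : world | (tnth w.2 t : R) < 0].
Proof.
have := measurable_fun_ltr (mU t) (measurable_cst (0 : R)).
by move=> /(_ measurableT [set true] Logic.I); rewrite setTI.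
Qed.

(** Restricting [Ps] to X = [x], dividing by the probability of the path and keeping (Y, A) gives
    the coupling. *)
Lemma structural_law_coupling b Ps x :
  structural_law tau Pobs b Ps -> 0 < probX Pobs x ->
  exists pi, feasible_coupling tau Pobs x b pi.
Proof.
move=> [margin eqn ge le] x0; pose c := (probX Pobs x)^-1.
have c0 : 0 <= c by rewrite invr_ge0 ltW.
pose S := [set w : world | w.1.1.2 = x].
have mS : measurable S := measurable_preimage mX12 (measurable_xpath1 x).
pose g (w : world) := (w.1.1.1, w.1.2).
have mg : measurable_fun setT g by exact: measurable_fun_pair.
have [mu muE] := pushforward_exists (mscale (NngNum c0) (mrestr Ps mS)) mg.
have marginS (C : set (vec R T)) : measurable C ->
    (Ps ((fun w => C w.1.1.1) `&` S) = Pobs (C `*` [set x]))%E.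
  by move=> mC; rewrite -margin//; apply: measurableX => //; exact: measurable_xpath1.
have [|pi piE] := @probability_exists _ _ _ mu.
  rewrite muE /= /mscale/= /mrestr preimage_setT.
  rewrite (_ : _ `&` S = (fun w : world => setT w.1.1.1) `&` S)//.
  by rewrite marginS// -probXE -EFinM mulVf// gt_eqF.
have {muE}piE D : (pi D = c%:E * Ps (g @^-1` D `&` S))%E by rewrite piE muE.
(* A test set for A on this path is a rectangle for (X, A) with first side the singleton of [x], so
   the structural bounds apply to it. *)
have XAE (C : set (measurableTypeR R)) : g @^-1` (snd @^-1` C) `&` S =
    (fun w : world => (w.1.1.2, w.1.2)) @^-1` ([set x] `*` C).
  by apply/seteqP; split=> w [].
have mxC (C : set (measurableTypeR R)) : measurable C -> measurable ([set x] `*` C).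
  by move=> mC; apply: measurableX => //; exact: measurable_xpath1.
have mgD D : measurable D -> measurable (g @^-1` D `&` S).
  by move=> mD; apply: measurableI => //; exact: measurable_preimage.
(* On this path the sign of U_t is that of the residual minus A, up to a null set; the events are
   therefore compared through [le_measure_ae]. *)
have eqnS t : {ae Ps, forall w : world, S w ->
    tnth w.2 t = resid w.1.1.1 x b t - w.1.2}.
  apply: ae_mono (eqn t) => w E xw; rewrite /resid E -xw.
  by ring.
exists pi; split=> [C mC|t|t].
- by rewrite piE marginS// cond_lawE.
- apply/cond_prob_geP => //; first exact: measurable_resid_le.
  move=> C mC; rewrite !piE muleCA lee_wpmul2l//.
  rewrite XAE; apply: le_trans ((cond_prob_geP _ mXA (mU_le0 t) tau).1 (ge t) _ (mxC C mC)) _.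
  apply: le_measure_ae.
  + by apply: measurableI => //; apply: measurable_preimage => //; exact: mxC.
  + apply: mgD; apply: measurableI; first exact: measurable_resid_le.
    exact: measurable_preimage.
  + apply: ae_mono (eqnS t) => w /= E [+ [xw Cw]]; rewrite E// subr_le0.
    by [].
- apply/cond_prob_leP => //; first exact: measurable_resid_lt.
  move=> C mC; rewrite !piE muleCA lee_wpmul2l//.
  rewrite XAE; apply: le_trans _ ((cond_prob_leP _ mXA (mU_lt0 t) tau).1 (le t) _ (mxC C mC)).
  apply: le_measure_ae.
  + apply: mgD; apply: measurableI; first exact: measurable_resid_lt.
    exact: measurable_preimage.
  + by apply: measurableI => //; apply: measurable_preimage => //; exact: mxC.
  + apply: ae_mono (eqnS t) => w /= E [[+ Cw] xw]; rewrite E// subr_lt0.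
    by [].
Qed.

(** With U_t set to the residual minus A, the outcome equation holds at every point and the sign
    events for U_t become those of the coupling. *)
Let world_of b x (ya : vec R T * measurableTypeR R) : world :=
  (ya.1, x, ya.2, [tuple (resid ya.1 x b t - ya.2 : measurableTypeR R) | t < T]).

Let measurable_world_of b x : measurable_fun setT (world_of b x).
Proof.
apply: measurable_fun_pair; first apply: measurable_fun_pair => //.
  exact: measurable_fun_pair.
apply/measurable_fun_tnthP => t.
rewrite (_ : _ \o _ = fun ya : vec R T * measurableTypeR R =>
    (resid ya.1 x b t - ya.2 : measurableTypeR R)).
  apply: measurable_funB => //.
  exact: measurableT_comp (measurable_resid x b t) measurable_fst.
by apply/funext => ya /=; rewrite tnth_mktuple.
Qed.

(** An almost sure statement asks for a measurable null set containing the exceptions; the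
    complement of this set serves. *)
Let measurable_eqn b t : measurable [set w : world |
  (tnth w.1.1.1 t : R) = dotv (tnth w.1.1.2 t) b + w.1.2 + tnth w.2 t].
Proof.
have mdot : measurable_fun setT (fun w : world => dotv (tnth w.1.1.2 t) b).
  apply: measurable_sum => i; apply: measurable_funM => //.
  apply: measurableT_comp (measurable_tnth i) _.
  exact: measurableT_comp (measurable_tnth t) mX12.
have mY : measurable_fun setT (fun w : world => (tnth w.1.1.1 t : R)).
  exact: measurableT_comp (measurable_tnth t) mX111.
have := measurable_fun_eqr mY
  (measurable_funD (measurable_funD mdot mA) (mU t)).
move=> /(_ measurableT [set true] Logic.I); rewrite setTI.
congr (measurable _); apply/seteqP; split=> w /=; first by move/eqP.
by move=> ->; rewrite eqxx.
Qed.

(** Each coupling is embedded in the structural space and the results are mixed with weights P(X =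
    x). The integrated bounds are linear in the law, so they pass to the mixture term by term. *)
Lemma couplings_structural_law b : X_finite_support Pobs ->
  (forall x, 0 < probX Pobs x -> exists pi, feasible_coupling tau Pobs x b pi) ->
  exists Ps, structural_law tau Pobs b Ps.
Proof.
move=> [F [/finite_seqP[s0 ->{F}] PF]] couplings.
(* A path listed twice would enter the mixture twice. *)
pose s := undup s0; have us : uniq s := undup_uniq s0.
have mfib x : measurable (@snd (vec R T) _ @^-1` [set x]).
  exact: measurable_preimage measurable_snd (measurable_xpath1 x).
have fibE x (D : set (vec R T * xpath R T k)) :
    D `&` snd @^-1` [set x] = (fun y => D (y, x)) `*` [set x].
  by apply/seteqP; split=> -[y x'] /= [+ xx']; rewrite xx'.
have sumPobs : (\sum_(x <- s) Pobs (snd @^-1` [set x]) = 1)%E.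
  rewrite -PF; transitivity (Pobs (setT `&` [set w | w.2 \in s])).
    rewrite measure_fibers//.
    by apply: eq_bigr => x _; rewrite setTI.
  congr (Pobs _); apply/seteqP; split=> w /=; first by rewrite mem_undup => -[].
  by rewrite mem_undup.
have probXfib x : Pobs (snd @^-1` [set x]) = (probX Pobs x)%:E.
  by rewrite probXE -[X in Pobs X]setTI fibE.
have sum1 : \sum_(x <- s) probX Pobs x = 1.
  apply: EFin_inj; rewrite -sumEFin -sumPobs.
  by apply: eq_bigr => x _; rewrite probXfib.
(* A law is chosen for every path; on a path of probability zero any law will do, since its weight
   is zero. *)
have /choice[pi piP] : forall x, exists pi, 0 < probX Pobs x ->
    feasible_coupling tau Pobs x b pi.
  move=> x; have [/couplings[pi piP]|_] := ltP 0 (probX Pobs x); first by exists pi.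
  by exists point.
have /choice[P PE] : forall x, exists P : probability world R,
    forall D, P D = pi x (world_of b x @^-1` D).
  move=> x; have [mu muE] := pushforward_exists (pi x) (measurable_world_of b x).
  have [|P PE] := @probability_exists _ _ _ mu.
    by rewrite muE preimage_setT; exact: probability_setT.
  by exists P => D; rewrite PE muE.
have [Ps PsE] := mixture_exists P (probX_ge0 Pobs) sum1.
have mslice x (C : set (xpath R T k * measurableTypeR R)) :
    measurable C -> measurable (pair x @^-1` C).
  by move=> mC; exact: measurable_preimage (pair1_measurable x) mC.
exists Ps; split=> [D mD|t|t|t].
- rewrite PsE (probability_fibers us _ mD sumPobs)//; apply: eq_bigr => x _.
  have mDx : measurable (fun y => D (y, x)).
    exact: measurable_preimage (pair2_measurable x) mD.
  rewrite PE fibE.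
  have [x0|x0] := ltP 0 (probX Pobs x).
    have [marg _ _] := piP _ x0.
    rewrite -[X in (_ * pi x X)%E]/[set w | (fun y => D (y, x)) w.1] marg//.
    by rewrite cond_lawE// muleA -EFinM divff ?mul1e// gt_eqF.
  (* On a path of probability zero both sides vanish: one through its weight, the other as the mass
     of a subset of a null set. *)
  have px0 : probX Pobs x = 0 by apply/eqP; rewrite eq_le x0 probX_ge0.
  rewrite px0 mul0e; apply/esym/eqP; rewrite eq_le measure_ge0 andbT.
  have <- : (probX Pobs x)%:E = 0%E by rewrite px0.
  rewrite probXE; apply: (le_measure Pobs); rewrite ?inE; last by move=> w [].
    by apply: measurableX => //; exact: measurable_xpath1.
  by apply: measurableX => //; exact: measurable_xpath1.
- exists (~` [set w : world |
    (tnth w.1.1.1 t : R) = dotv (tnth w.1.1.2 t) b + w.1.2 + tnth w.2 t]); split.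
  + exact: measurableC.
  + rewrite PsE big1// => x _; rewrite PE [X in pi x X](_ : _ = set0) ?measure0 ?mule0//.
    apply/seteqP; split=> // ya /=; apply.
    by rewrite tnth_mktuple /resid; ring.
  + by [].
- apply/cond_prob_geP => // C mC; rewrite !PsE ge0_sume_distrr; last first.
    by move=> x _; rewrite mule_ge0// lee_fin probX_ge0.
  apply: lee_sum => x _; rewrite !PE muleCA.
  have [x0|x0] := ltP 0 (probX Pobs x); last first.
    have -> : probX Pobs x = 0 by apply/eqP; rewrite eq_le x0 probX_ge0.
    by rewrite !mul0e.
  rewrite lee_wpmul2l ?lee_fin ?probX_ge0//.
  have [_ ge _] := piP _ x0.
  (* Under [world_of] the path is fixed, so a test set for (X, A) becomes its slice at [x], a test
     set for A alone. *)
  have := (cond_prob_geP _ measurable_snd (measurable_resid_le x b t) tau).1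
    (ge t) _ (mslice x C mC).
  congr (_ <= pi x _)%E.
  by apply/seteqP; split=> ya /= [+ ?]; rewrite tnth_mktuple subr_le0.
- apply/cond_prob_leP => // C mC; rewrite !PsE ge0_sume_distrr; last first.
    by move=> x _; rewrite mule_ge0// lee_fin probX_ge0.
  apply: lee_sum => x _; rewrite !PE [leRHS]muleCA.
  have [x0|x0] := ltP 0 (probX Pobs x); last first.
    have -> : probX Pobs x = 0 by apply/eqP; rewrite eq_le x0 probX_ge0.
    by rewrite !mul0e.
  rewrite lee_wpmul2l ?lee_fin ?probX_ge0//.
  have [_ _ le] := piP _ x0.
  have := (cond_prob_leP _ measurable_snd (measurable_resid_lt x b t) tau).1
    (le t) _ (mslice x C mC).
  congr (pi x _ <= _)%E.
  by apply/seteqP; split=> ya /= [+ ?]; rewrite tnth_mktuple subr_lt0.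
Qed.

End structural_laws_and_couplings.

(** * Bins of the latent effect between consecutive values *)

Section binning.
Context (R : realType).
Implicit Types (v : seq R) (a w : R).

(** For strictly increasing [v], the count is [i.+1] when [a] lies in the bin opening at entry [i],
    and 0 below all entries; one formula thus covers every bin, unbounded ones included. Comparing
    [a] with the head shifts the count by one or leaves it, whence the induction. *)
Lemma measurable_count_le v n :
  measurable [set a : measurableTypeR R | count (<= a) v = n].
Proof.
elim: v n => [|w v IH] n /=.
  have [->|n0] := eqVneq n 0%N.
    by rewrite (_ : mkset _ = setT)//; apply/seteqP.
  rewrite (_ : mkset _ = set0)//; apply/seteqP; split=> // a /= E.
  by rewrite -E in n0.
have mw : measurable [set a : measurableTypeR R | w <= a].
  rewrite (_ : mkset _ = `[w, +oo[%classic); first exact: measurable_itv.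
  by apply/seteqP; split=> a /=; rewrite in_itv/= andbT.
rewrite (_ : mkset _ =
    [set a : measurableTypeR R | w <= a] `&` [set a | (count (<= a) v).+1 = n] `|`
    (~` [set a : measurableTypeR R | w <= a] `&` [set a | count (<= a) v = n])).
  apply: measurableU; apply: measurableI => //; last exact: measurableC.
  case: n => [|n].
    by rewrite (_ : mkset _ = set0)//; apply/seteqP; split.
  rewrite (_ : mkset _ = [set a : measurableTypeR R | count (<= a) v = n])//.
  by apply/seteqP; split=> a /=; [case|move=> ->].
apply/seteqP; split=> a /=; rewrite /Order.ge/=; case: (leP w a) => wa.
- by rewrite add1n; left.
- by rewrite add0n; right.
- by rewrite add1n => -[[]//|[]//].
- by rewrite add0n => -[[]//|[]//].
Qed.

(** In a sorted list the entries at most [a] form an initial segment, here of length [i.+1], so [w]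
    has no need of a position beyond [i]. *)
Lemma le_nth_count v i a w : sorted <=%O v -> count (<= a) v = i.+1 ->
  w \in v -> w <= a -> w <= v`_i.
Proof.
move=> sv ci wv wa; have mv : (index w v < size v)%N by rewrite index_mem.
have iv : (i < size v)%N by rewrite -ci count_size.
have [mi|im] := leqP (index w v) i.
  by rewrite -[w](nth_index 0 wv); apply: sorted_leq_nth => //; exact: le_trans.
have := @nth_count_gt _ _ a 0 v (index w v) sv.
by rewrite ci im mv nth_index// ltNge wa => /(_ isT).
Qed.

End binning.

(** * Couplings and solutions of the linear system *)

Section couplings_and_linear_system.
Context (R : realType) (T k : nat) (tau : R).
Variable Pobs : probability (vec R T * xpath R T k)%type R.
Variables (x : xpath R T k) (b : vec R k) (J : nat).
Variables (y : 'I_J -> vec R T) (p : 'I_J -> R).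
Hypothesis atoms : cond_atoms Pobs x y p.

Let z j t := resid (y j) x b t.
Let v := distinct_values z.

Let sv : sorted <=%O v.
Proof. exact: sort_le_sorted. Qed.

Let zv j t : z j t \in v.
Proof.
rewrite mem_sort mem_undup; apply/allpairsP; exists (j, t).
by rewrite !mem_enum.
Qed.

(** The atoms have total mass 1, so [f] almost surely hits one of them. A general [f] covers both
    the first coordinate of a coupling and the identity on outcomes. *)
Lemma law_on_atoms d (W : measurableType d) (P : probability W R)
    (f : W -> vec R T) (D : set W) :
  measurable_fun setT f -> (forall j, P (f @^-1` [set y j]) = (p j)%:E) ->
  measurable D -> (P D = \sum_j P (D `&` f @^-1` [set y j]))%E.
Proof.
case: atoms => yinj _ _ sp mf Pp mD.
have us : uniq [seq y j | j <- enum 'I_J] by rewrite map_inj_uniq// enum_uniq.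
rewrite (probability_fibers us _ mD (f := f)).
- by rewrite big_map big_enum.
- by move=> u _; exact: measurable_preimage mf (measurable_vec1 u).
- rewrite big_map big_enum/= (eq_bigr (fun j => (p j)%:E))//.
  by rewrite sumEFin sp.
Qed.

(** The bounds are tested on bins of A only; splitting a bin over the atoms turns each bound into a
    row of the system. *)
Lemma coupling_LS_feasible (t0 : 'I_T) pi : 0 < tau ->
  feasible_coupling tau Pobs x b pi -> LS_feasible tau x b y p.
Proof.
move=> tau0 [margin ge le]; rewrite /LS_feasible -/z -/v.
have piY j : (pi (fst @^-1` [set y j]) = (p j)%:E)%E.
  have [_ _ py _] := atoms.
  by rewrite -(py j) -margin//; exact: measurable_vec1.
have fib := law_on_atoms measurable_fst piY.
pose bin n := [set w : vec R T * measurableTypeR R | count (<= w.2) v = n].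
have mbin n : measurable (bin n).
  exact: measurable_preimage measurable_snd (measurable_count_le v n).
have mY j : measurable (@fst (vec R T) (measurableTypeR R) @^-1` [set y j]).
  exact: measurable_preimage measurable_fst (measurable_vec1 _).
have ge_bin t n : (tau%:E * pi (bin n) <=
    pi ([set w | (resid w.1 x b t <= w.2)%R] `&` bin n))%E.
  exact: (cond_prob_geP _ measurable_snd (measurable_resid_le x b t) tau).1
    (ge t) _ (measurable_count_le v n).
have le_bin t n : (pi ([set w | (resid w.1 x b t < w.2)%R] `&` bin n) <=
    tau%:E * pi (bin n))%E.
  exact: (cond_prob_leP _ measurable_snd (measurable_resid_lt x b t) tau).1
    (le t) _ (measurable_count_le v n).
(* Here A is below every value, so no atom has its residual at date [t0] at most A; the lower bound
   with [tau > 0] forces mass zero. *)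
have bin0 : pi (bin 0%N) = 0%E.
  apply/eqP; rewrite eq_le measure_ge0 andbT -(lee_pmul2l _ (x := tau%:E))//.
  rewrite mule0; apply: le_trans (ge_bin t0 0%N) _.
  rewrite fib; last by apply: measurableI => //; exact: measurable_resid_le.
  rewrite big1// => j _; rewrite [X in pi X](_ : _ = set0) ?measure0//.
  apply/seteqP; split=> // w /= [[za w0] wy]; rewrite wy in za.
  have : has (<= w.2) v by apply/hasP; exists (z j t0).
  by rewrite has_count w0.
(* Indices into [v] start at 0, so the bin opening at entry [i] is the one with count [i.+1]. *)
pose q j (i : 'I_(size v)) := fine (pi (bin i.+1 `&` fst @^-1` [set y j])).
have mq j n : measurable (bin n `&` fst @^-1` [set y j]) by exact: measurableI.
have qE j i : (q j i)%:E = pi (bin i.+1 `&` fst @^-1` [set y j]).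
  by rewrite fineK// fin_num_measure.
have sumq i : (\sum_j q j i)%:E = pi (bin i.+1).
  by rewrite -sumEFin fib//; apply: eq_bigr => j _; rewrite qE.
exists q; split=> [j i|j|i t|i t].
- by rewrite fine_ge0.
- apply: EFin_inj; rewrite -piY -sumEFin.
  (* Counts run from 0 to [size v]; removing the null bin 0 leaves exactly the indices of [q]. *)
  pose s := index_iota 0 (size v).+1.
  have mfib n : n \in s -> measurable
      ((fun w : vec R T * measurableTypeR R => count (<= w.2) v) @^-1` [set n]).
    by move=> _; exact: mbin.
  have us : uniq s := iota_uniq _ _.
  have := measure_fibers us mfib pi (mY j).
  rewrite (_ : [set w | _ \in s] = setT); last first.
    apply/seteqP; split=> // w _ /=.
    by rewrite mem_index_iota ltnS count_size.
  rewrite setIT => ->; rewrite big_nat_recl//.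
  rewrite [X in (X + _)%E](_ : _ = 0%E) ?add0e; last first.
    apply/eqP; rewrite eq_le measure_ge0 andbT -bin0.
    apply: (le_measure pi); rewrite ?inE//. by apply: measurableI => //; exact: (mbin 0%N).
  by rewrite big_mkord; apply: eq_bigr => i _; rewrite qE setIC.
- rewrite -lee_fin EFinM sumq; apply: le_trans (ge_bin t _) _.
  rewrite fib; last by apply: measurableI => //; exact: measurable_resid_le.
  rewrite -sumEFin [leRHS]big_mkcond/=; apply: lee_sum => j _.
  (* An atom with residual above v_i contributes nothing: within the bin, a residual at most A is
     already at most v_i. *)
  case: ifPn => [_|zi].
    rewrite qE; apply: (le_measure pi); rewrite ?inE//; last by move=> w [[_ wi] wy].
    by do 2 apply: measurableI => //; exact: measurable_resid_le.
  rewrite [X in pi X](_ : _ = set0) ?measure0//.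
  apply/seteqP; split=> // w /= [[za wi] wy]; rewrite wy in za.
  by move/negP: zi; apply; exact: (le_nth_count sv wi (zv j t) za).
- rewrite -lee_fin EFinM sumq; apply: le_trans _ (le_bin t _).
  rewrite [leRHS]fib; last by apply: measurableI => //; exact: measurable_resid_lt.
  rewrite -sumEFin big_mkcond/=; apply: lee_sum => j _.
  case: ifPn => // zi.
  rewrite qE; apply: (le_measure pi); rewrite ?inE//.
    by do 2 apply: measurableI => //; exact: measurable_resid_lt.
  (* The residual is below v_i, and v_i is at most A throughout the bin. *)
  move=> w /= [wi wy]; split=> //; split=> //; rewrite wy.
  by apply: lt_le_trans zi _; apply: nth_count_le => //; rewrite wi.
Qed.

(** [cond_atoms] prescribes masses of singletons only. Realizing the conditional law as a
    probability [Q] lets [law_on_atoms], with the identity map, reach all measurable sets. *)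
Lemma cond_law_atoms (C : set (vec R T)) : 0 < probX Pobs x -> measurable C ->
  cond_law Pobs x C = \sum_j p j * (y j \in C)%:R.
Proof.
move=> x0 mC; have [_ _ py _] := atoms.
have c0 : 0 <= (probX Pobs x)^-1 by rewrite invr_ge0 ltW.
have mS : measurable (@snd (vec R T) _ @^-1` [set x]).
  exact: measurable_preimage measurable_snd (measurable_xpath1 x).
have [mu muE] := pushforward_exists (mscale (NngNum c0) (mrestr Pobs mS)) measurable_fst.
have {}muE (D : set (vec R T)) : measurable D -> mu D = (cond_law Pobs x D)%:E.
  by move=> mD; rewrite muE cond_lawE.
have [|Q QE] := @probability_exists _ _ _ mu.
  by rewrite muE// cond_lawE// -probXE -EFinM mulVf// gt_eqF.
have Qp j : Q (id @^-1` [set y j]) = (p j)%:E.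
  by rewrite QE muE ?py//; exact: measurable_vec1.
apply: EFin_inj; rewrite -muE// -QE (law_on_atoms (f := id) _ Qp)//.
rewrite -sumEFin; apply: eq_bigr => j _.
have [yC|yC] := boolP (y j \in C).
  by rewrite mulr1 -Qp setIidr// => _ /= ->; exact/set_mem.
rewrite mulr0 [X in Q X](_ : _ = set0) ?measure0//.
by apply/seteqP; split=> // u /= [uC uy]; move/negP: yC; apply; rewrite inE -uy.
Qed.

(** The coupling puts mass [q j i] at (y_j, v_i). As A takes only the values v_i, the bound for a
    test set [C] is the sum of the rows with v_i in [C]. *)
Lemma LS_feasible_coupling : 0 < probX Pobs x ->
  LS_feasible tau x b y p -> exists pi, feasible_coupling tau Pobs x b pi.
Proof.
move=> x0; rewrite /LS_feasible -/z -/v => -[q [q0 qp qge qle]].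
pose P (ij : 'I_(size v) * 'I_J) : probability (vec R T * measurableTypeR R)%type R :=
  dirac (y ij.2, v`_ij.1 : measurableTypeR R).
have [_ _ _ sp] := atoms.
have q1 : \sum_(ij : 'I_(size v) * 'I_J) q ij.2 ij.1 = 1.
  rewrite -(pair_bigA _ (fun i j => q j i))/= exchange_big/= -sp.
  by apply: eq_bigr => j _.
have [pi piE'] := mixture_exists P (fun ij => q0 ij.2 ij.1) q1.
have piE D : pi D = (\sum_i \sum_j q j i * ((y j, v`_i) \in D)%:R)%:E.
  rewrite piE' (pair_bigA _ (fun i j => q j i * ((y j, v`_i) \in D)%:R)) /= -sumEFin.
  by apply: eq_bigr => ij _; rewrite EFinM /= diracE.
have sum_snd i (C : set (measurableTypeR R)) :
    \sum_j q j i * ((y j, v`_i) \in snd @^-1` C)%:R =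
    (\sum_j q j i) * ((v`_i : measurableTypeR R) \in C)%:R.
  rewrite mulr_suml; apply: eq_bigr => j _.
  by congr (_ * _%:R); congr nat_of_bool; apply/idP/idP; rewrite !inE.
have sum_snd_if (i : 'I_(size v)) (C : set (measurableTypeR R))
    (E : set (vec R T * measurableTypeR R))
    (e : pred 'I_J) : (forall j, ((y j, v`_i) \in E) = e j) ->
    \sum_j q j i * ((y j, v`_i) \in E `&` snd @^-1` C)%:R =
    (\sum_(j | e j) q j i) * ((v`_i : measurableTypeR R) \in C)%:R.
  move=> Ee; rewrite mulr_suml [RHS]big_mkcond/=; apply: eq_bigr => j _.
  rewrite in_setI Ee; case: (e j); last by rewrite mulr0.
  by congr (_ * _%:R); congr nat_of_bool; apply/idP/idP; rewrite !inE.
exists pi; split=> [C mC|t|t].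
- rewrite piE cond_law_atoms// exchange_big/=; congr (_%:E).
  apply: eq_bigr => j _; rewrite -qp mulr_suml; apply: eq_bigr => i _.
  by congr (_ * _%:R); congr nat_of_bool; apply/idP/idP; rewrite !inE.
- apply/cond_prob_geP => //; first exact: measurable_resid_le.
  move=> C mC; rewrite !piE -EFinM lee_fin mulr_sumr; apply: ler_sum => i _.
  rewrite sum_snd (sum_snd_if _ _ _ (fun j => resid (y j) x b t <= v`_i)) => [|j].
    by rewrite mulrA ler_wpM2r.
  by apply/idP/idP; rewrite inE.
- apply/cond_prob_leP => //; first exact: measurable_resid_lt.
  move=> C mC; rewrite !piE -EFinM lee_fin mulr_sumr; apply: ler_sum => i _.
  rewrite sum_snd (sum_snd_if _ _ _ (fun j => resid (y j) x b t < v`_i)) => [|j].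
    by rewrite mulrA ler_wpM2r.
  by apply/idP/idP; rewrite inE.
Qed.

End couplings_and_linear_system.

Theorem theorem6p1 (R : realType) (T k : nat) (hT : (1 <= T)%N)
    (hk : (1 <= k)%N) (tau : R) (htau0 : 0 < tau) (htau1 : tau < 1)
    (B : set (vec R k))
    (Pobs : probability (vec R T * xpath R T k)%type R)
    (hX : X_finite_support Pobs) :
  (forall (x : xpath R T k) (J : nat) (y : 'I_J -> vec R T) (p : 'I_J -> R)
      (b : vec R k),
    0 < probX Pobs x -> cond_atoms Pobs x y p -> B b ->
    ((exists pi, feasible_coupling tau Pobs x b pi) <->
     LS_feasible tau x b y p))
  /\
  (forall (J : xpath R T k -> nat)
      (y : forall x : xpath R T k, 'I_(J x) -> vec R T)
      (p : forall x : xpath R T k, 'I_(J x) -> R),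
    (forall x, 0 < probX Pobs x -> cond_atoms Pobs x (y x) (p x)) ->
    identified_set tau B Pobs =
    [set b | B b /\
      forall x, 0 < probX Pobs x -> LS_feasible tau x b (y x) (p x)]).
Proof.
(* A date exists because [T] is at least 1; it serves to show that a coupling has no mass with A
   below v_1. *)
have t0 : 'I_T := Ordinal hT.
have LS_coupling x J (y : 'I_J -> vec R T) (p : 'I_J -> R) b :
    0 < probX Pobs x -> cond_atoms Pobs x y p ->
    (exists pi, feasible_coupling tau Pobs x b pi) <-> LS_feasible tau x b y p.
  move=> x0 atoms; split=> [[pi]|]; first exact: (coupling_LS_feasible atoms t0).
  exact: LS_feasible_coupling.
split=> [x J y p b x0 atoms _|J y p atoms]; first exact: LS_coupling.
apply/seteqP; split=> b /= [Bb H]; split=> //.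
  move=> x x0; apply/(LS_coupling _ _ _ _ _ x0 (atoms x x0)).
  by case: H => Ps Psb; exact: structural_law_coupling Psb x0.
apply: couplings_structural_law => // x x0.
by apply/(LS_coupling _ _ _ _ _ x0 (atoms x x0)); exact: H.
Qed.
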